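(* Let $N\ge 2$, $r=\lfloor N/2\rfloor$, and let $\mathcal{Q}$ be a period-$1$ quiver on the vertices $x_1,\dots,x_N$ whose exchange matrix has the form $$B=c_1B^{(1)}+\cdots+c_rB^{(r)}+B',$$ where $c_1,\dots,c_r\in\mathbb{Z}$, $B^{(t)}$ is the matrix of the primitive quiver $P_N^{(t)}$, and $B'$ is a skew-symmetric integer matrix whose first row and first column are zero. Then there exists a nonzero period-$1$ weight function $w:\{x_1,\dots,x_N\}\to\mathbb{Z}$ on $\mathcal{Q}$ if and only if $$[c_1]_-+\cdots+[c_r]_-=1\quad\text{if }N\text{ is odd},\qquad 2[c_1]_-+\cdots+2[c_{r-1}]_-+[c_r]_-=2\quad\text{if }N\text{ is even}.$$ Moreover, a period-$1$ weight function is unique up to an integer multiple.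
   Context: A quiver on vertices $x_1,\dots,x_N$ (no loops, no $2$-cycles) is encoded by a skew-symmetric integer matrix $B=(b_{ij})$: if $b_{ij}>0$ there are $b_{ij}$ arrows $x_i\to x_j$, if $b_{ij}<0$ there are $-b_{ij}$ arrows $x_j\to x_i$. For an integer $c$ write $[c]_+=\max(c,0)$ and $[c]_-=\max(-c,0)$. The mutation $\mu_k$ at $x_k$: for every path $x_i\to x_k\to x_j$ add an arrow $x_i\to x_j$; reverse all arrows incident to $x_k$; remove the $2$-cycles created. The quiver is of period $1$ if the mutated quiver $\mu_1(\mathcal{Q})$, with its vertices relabeled $x_i\mapsto x_{i-1}$ for $i\ge2$ and $x_1\mapsto x_N$, coincides with $\mathcal{Q}$. A weight function is a map $w:\{x_1,\dots,x_N\}\to\mathbb{Z}$, $w_i:=w(x_i)$; its mutation at $x_k$ is $\mu_k(w)(x_k)=-w_k$ and $\mu_k(w)(x_i)=w_i+[b_{ki}]_+w_k$ for $i\neq k$. A weight function on a period-$1$ quiver is of period $1$ if $\mu_1(w)(x_1)=w_N$ and $\mu_1(w)(x_{i+1})=w_i$ for $1\le i\le N-1$ (i.e. it is carried back to $w$ by the same relabeling). For $1\le t\le N/2$, the primitive quiver $P_N^{(t)}$ has exactly one arrow between $x_i$ and $x_j$ for each unordered pair $\{i,j\}\subset\{1,\dots,N\}$ with $i-j\equiv\pm t \pmod N$, oriented from the vertex with the larger label to the one with the smaller label, and no other arrows; $B^{(t)}$ denotes its matrix. *)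

(* Defs.v *)
From HB Require Import structures.
From mathcomp Require Import all_boot all_order all_algebra.

Set Implicit Arguments.
Unset Strict Implicit.
Unset Printing Implicit Defensive.

Import Order.TTheory GRing.Theory Num.Theory.
Local Open Scope ring_scope.

(* The vertex x_i is the ordinal i - 1 of 'I_N. A quiver is given by its
   exchange matrix; there are ppart (B i j) arrows from i to j. *)

Definition ppart (c : int) : int := Num.max c 0.
Definition npart (c : int) : int := Num.max (- c) 0.

Definition skew_symmetric (N : nat) (B : 'M[int]_N) : Prop := B^T = - B.

Definition vertex1 (N : nat) (hN : (2 <= N)%N) : 'I_N := Ordinal (ltnW hN).

Definition arrows (N : nat) (B : 'M[int]_N) (i j : 'I_N) : int :=
  ppart (B i j).

Definition compose_paths (N : nat) (k : 'I_N) (a : 'I_N -> 'I_N -> int)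
    (i j : 'I_N) : int :=
  a i j + a i k * a k j.

Definition reverse_at (N : nat) (k : 'I_N) (a : 'I_N -> 'I_N -> int)
    (i j : 'I_N) : int :=
  if (i == k) || (j == k) then a j i else a i j.

(* Taking the difference of the two arrow counts removes the 2-cycles. *)
Definition cancel_2cycles (N : nat) (a : 'I_N -> 'I_N -> int) : 'M[int]_N :=
  \matrix_(i, j) (a i j - a j i).

Definition mutate (N : nat) (k : 'I_N) (B : 'M[int]_N) : 'M[int]_N :=
  cancel_2cycles (reverse_at k (compose_paths k (arrows B))).

(* The relabelling x_i |-> x_(i-1), x_1 |-> x_N is ord_pred. *)
Definition quiver_period1 (N : nat) (hN : (2 <= N)%N) (B : 'M[int]_N) : Prop :=
  forall i j : 'I_N, mutate (vertex1 hN) B i j = B (ord_pred i) (ord_pred j).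

Definition mutate_weight (N : nat) (k : 'I_N) (B : 'M[int]_N)
    (w : {ffun 'I_N -> int}) : {ffun 'I_N -> int} :=
  [ffun i => if i == k then - w k else w i + ppart (B k i) * w k].

Definition weight_period1 (N : nat) (hN : (2 <= N)%N) (B : 'M[int]_N)
    (w : {ffun 'I_N -> int}) : Prop :=
  forall i : 'I_N, mutate_weight (vertex1 hN) B w i = w (ord_pred i).

(* i - j = t or i - j = - t modulo N, rearranged to avoid truncated subtraction. *)
Definition primitive_adj (N t : nat) (i j : 'I_N) : bool :=
  (i == j + t %[mod N])%N || (i + t == j %[mod N])%N.

Definition primitive_mx (N t : nat) : 'M[int]_N :=
  \matrix_(i, j)
    if (i != j) && primitive_adj t i j then (if (j < i)%N then 1 else - 1)
    else 0.

(* Main.v *)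
(* Put [a_j := ppart (B x_1 x_(j+1))]. A weight of period 1 satisfies
   [w_(j+1) = w_j - a_j w_1], so it equals [w_1 (1 - a_1 - ... - a_(j-1))] at
   [x_j], and the remaining equation [- w_1 = w_N] reads [w_1 (2 - S) = 0],
   where [S := a_1 + ... + a_(N-1)]. Since [a_j] is the negative part of
   [c_(min (j, N - j))], folding [S] around [N / 2] gives [2] times the left-hand
   side of the criterion when [N] is odd, and that left-hand side itself when
   [N] is even. *)

Require Import Defs.
From HB Require Import structures.
From mathcomp Require Import all_boot all_order all_algebra.
From mathcomp Require Import zify ring.

Set Implicit Arguments.
Unset Strict Implicit.
Unset Printing Implicit Defensive.

Import Order.TTheory GRing.Theory Num.Theory.
Local Open Scope ring_scope.

(** Seen from [x_1], which is the ordinal [0], adjacency means [j = t] or [j = N - t]; the bound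
    [t <= N / 2] makes [t] the smaller of [j] and [N - j]. *)
Lemma primitive_adj0 (N t : nat) (hN : (2 <= N)%N) (j : 'I_N) :
  (0 < j)%N -> (0 < t <= N %/ 2)%N ->
  primitive_adj t (vertex1 hN) j = (t == minn j (N - j)).
Proof.
move=> j0 /andP[t0 tN]; have jN := ltn_ord j.
have tlt : (t < N)%N by lia.
rewrite /primitive_adj /= add0n mod0n (modn_small jN) (modn_small tlt).
(* As [0 < j + t < 2 * N], the only multiple of [N] it can be is [N]. *)
suff -> : (0 == (j + t) %% N)%N = (j + t == N)%N by lia.
apply/eqP/eqP => [h|->]; last by rewrite modnn.
have := divn_eq (j + t) N; rewrite -h addn0.
have : ((j + t) %/ N < 2)%N by rewrite ltn_divLR; lia.
by case: (_ %/ _)%N => [|[|]]; lia.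
Qed.

(** Exactly one primitive quiver joins [x_1] to a given other vertex. The sign is negative because
    [x_1] has the smallest label, so its arrows all point towards it. *)
Lemma row1_primitive_sum (N : nat) (hN : (2 <= N)%N) (B' : 'M[int]_N)
    (c : nat -> int) (j : 'I_N) :
  row (vertex1 hN) B' = 0 -> (0 < j)%N ->
  (\sum_(1 <= t < (N %/ 2).+1) c t *: primitive_mx N t + B') (vertex1 hN) j
  = - c (minn j (N - j)).
Proof.
move=> /rowP/(_ j); rewrite !mxE => -> j0; rewrite addr0 summxE.
have jN := ltn_ord j.
rewrite (eq_big_nat _ _
  (F2 := fun t => if t == minn j (N - j) then - c t else 0)); last first.
  move=> t ht; rewrite !mxE primitive_adj0 // ltn0.
  have -> : vertex1 hN != j by rewrite -val_eqE /= neq_ltn j0.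
  by rewrite andTb; case: ifP => _; rewrite ?mulr0 ?mulrN1.
rewrite -big_mkcond big_nat1_eq ifT //; lia.
Qed.

(** The reflection of [j] to [N - j] pairs equal terms; for even [N] it fixes [N / 2], which is
    counted once. *)
Lemma sum_minn_fold (V : nmodType) (f : nat -> V) (N : nat) : (2 <= N)%N ->
  \sum_(1 <= j < N) f (minn j (N - j)) =
  if odd N then (\sum_(1 <= t < (N %/ 2).+1) f t) *+ 2
  else (\sum_(1 <= t < N %/ 2) f t) *+ 2 + f (N %/ 2)%N.
Proof.
move=> hN; rewrite (big_cat_nat (n := (N %/ 2).+1)) /=; [|lia..].
have -> : \sum_((N %/ 2).+1 <= j < N) f (minn j (N - j)) =
          \sum_(1 <= t < N - N %/ 2) f t.
  (* Reversing the range and shifting it by [N / 2] substitutes [N - t] for [j]. *)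
  rewrite big_nat_rev /= -[X in \sum_(X <= _ < _) _]add1n big_addn.
  by apply: eq_big_nat => t ht; congr f; lia.
have -> : \sum_(1 <= j < (N %/ 2).+1) f (minn j (N - j)) =
          \sum_(1 <= t < (N %/ 2).+1) f t.
  by apply: eq_big_nat => t ht; congr f; lia.
case: ifP => hodd.
  by have -> : (N - N %/ 2 = (N %/ 2).+1)%N by lia.
have -> : (N - N %/ 2 = N %/ 2)%N by lia.
have r0 : (1 <= N %/ 2)%N by lia.
by rewrite (big_nat_recr _ _ _ r0) addrAC mulr2n.
Qed.

Lemma weight_period1E (N : nat) (hN : (2 <= N)%N) (B : 'M[int]_N)
    (a : nat -> int) (w : {ffun 'I_N -> int}) :
  (forall j : 'I_N, (0 < j)%N -> ppart (B (vertex1 hN) j) = a j) ->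
  weight_period1 hN B w <->
  [/\ forall i : 'I_N, w i = w (vertex1 hN) * (1 - \sum_(1 <= j < i.+1) a j)
    & w (vertex1 hN) * (2 - \sum_(1 <= j < N) a j) = 0].
Proof.
move=> ha; set v := vertex1 hN.
have N0 : (0 < N)%N by lia.
have last_lt : (N.-1 < N)%N by rewrite prednK.
have pred_v : ord_pred v = Ordinal last_lt.
  by apply: val_inj; rewrite /= add0n modn_small.
have pred_val (i : 'I_N) : (0 < i)%N -> ord_pred i = i.-1 :> nat.
  move=> i0 /=; have iN := ltn_ord i.
  have -> : ((i + N).-1 = i.-1 + N)%N by lia.
  by rewrite modnDr modn_small //; lia.
have neq_v (i : 'I_N) : (i == v) = (i == 0 :> nat) by [].
split=> [hw|[hw hS] i].
  have step (i : 'I_N) : (0 < i)%N -> w i = w (ord_pred i) - a i * w v.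
    by move=> i0; rewrite -hw ffunE neq_v gtn_eqF // ha // addrK.
  have wE (i : 'I_N) : w i = w v * (1 - \sum_(1 <= j < i.+1) a j).
    case: i => n; elim: n => [|n IH] lt_n.
      rewrite big_geq // subr0 mulr1; congr (w _); exact: val_inj.
    rewrite step // big_nat_recr //=.
    have -> : ord_pred (Ordinal lt_n) = Ordinal (ltnW lt_n).
      by apply: val_inj; apply: pred_val.
    by rewrite IH /=; ring.
  split=> //; have := hw v.
  rewrite ffunE eqxx pred_v (wE (Ordinal last_lt)) /= prednK // => h.
  by rewrite -[2]/(1 + 1) -addrA mulrDr mulr1 -h subrr.
(* Conversely, the condition at [x_1] is the scalar equation [hS]; at the other vertices consecutive
   partial sums differ by one term. *)
rewrite ffunE neq_v; case: (posnP i) => [i0|i0].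
  have -> : i = v by apply: val_inj.
  rewrite pred_v [RHS]hw /= prednK //.
  by apply/esym/eqP; rewrite -subr_eq0 -[eqbRHS]hS; apply/eqP; ring.
rewrite ha // [w i]hw [RHS]hw pred_val // prednK // big_nat_recr //=.
ring.
Qed.

Theorem theorem2 (N r : nat) (hN : (2 <= N)%N) (hr : r = (N %/ 2)%N)
    (B B' : 'M[int]_N) (c : nat -> int)
    (hB : skew_symmetric B) (hper : quiver_period1 hN B)
    (hB' : skew_symmetric B')
    (hrow : row (vertex1 hN) B' = 0) (hcol : col (vertex1 hN) B' = 0)
    (hdec : B = \sum_(1 <= t < r.+1) c t *: primitive_mx N t + B') :
  ((exists w : {ffun 'I_N -> int}, w != 0 /\ weight_period1 hN B w) <->
   (if odd N then \sum_(1 <= t < r.+1) npart (c t) = 1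
    else \sum_(1 <= t < r) 2 * npart (c t) + npart (c r) = 2)) /\
  (exists w0 : {ffun 'I_N -> int}, forall w : {ffun 'I_N -> int},
     weight_period1 hN B w <-> exists m : int, w = w0 *~ m).
Proof.
pose a j := npart (c (minn j (N - j))).
pose S := \sum_(1 <= j < N) a j.
have ha (j : 'I_N) : (0 < j)%N -> ppart (B (vertex1 hN) j) = a j.
  (* [ppart (- x)] is [npart x] by definition. *)
  by move=> j0; rewrite hdec hr row1_primitive_sum.
have wP w := weight_period1E w ha.
have SE : (if odd N then \sum_(1 <= t < r.+1) npart (c t) = 1
           else \sum_(1 <= t < r) 2 * npart (c t) + npart (c r) = 2) <-> S = 2.
  rewrite /S (sum_minn_fold (fun t => npart (c t)) hN) -hr -mulr_sumr.
  by case: ifP => _; move: (\sum_(_ <= _ < _) _) => X; rewrite !mulr2n; lia.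
(* The solution of the recursion with value [1] at [x_1]; it has period 1 only when [S = 2]. *)
pose w1 : {ffun 'I_N -> int} := [ffun i : 'I_N => 1 - \sum_(1 <= j < i.+1) a j].
have w1v : w1 (vertex1 hN) = 1 by rewrite ffunE big_geq // subr0.
have mulzE (w : {ffun 'I_N -> int}) m i : (w *~ m) i = w i * m.
  by rewrite -mulrzz; case: m => n; rewrite ?NegzE ?mulrNz ?ffunE ffunMnE.
have solE w : weight_period1 hN B w <->
    w = w1 *~ w (vertex1 hN) /\ w (vertex1 hN) * (2 - S) = 0.
  rewrite wP; split=> [[h1 h2]|[h1 h2]]; split=> //.
    by apply/ffunP => i; rewrite mulzE ffunE mulrC.
  by move=> i; rewrite {1}h1 mulzE ffunE mulrC.
rewrite SE; split.
  split=> [[w [w_neq0 /solE[wE /eqP]]]|S2].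
    (* A weight of period 1 vanishing at [x_1] is zero, so a nonzero one forces [S = 2]. *)
    rewrite mulf_eq0 => /orP[/eqP w0|]; last by rewrite subr_eq0 => /eqP ->.
    by case/eqP: w_neq0; rewrite wE w0 mulr0z.
  exists w1; split; last by apply/solE; rewrite w1v mulr1z S2 subrr.
  by apply/eqP => w0; move: w1v; rewrite w0 ffunE.
(* The generator is [w1] if [S = 2]; otherwise only the zero weight remains, generated by [0]. *)
have [S2|S2] := eqVneq S 2.
  exists w1 => w; rewrite solE S2 subrr; split=> [[-> _]|[m ->]].
    by eexists.
  by rewrite mulzE w1v mul1r mulr0.
exists 0 => w; rewrite solE; split=> [[wE /eqP]|[m ->]].
  rewrite mulf_eq0 subr_eq0 [2 == S]eq_sym (negbTE S2) orbF => /eqP w0.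
  by exists 0; rewrite wE w0 !mulr0z.
by rewrite mul0rz ffunE mul0r mulr0z.
Qed.
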